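(* For every $h\ge2$, the minimal winning quota $q_h(x_1,\ldots,x_{h-1})$ of parsimonious games with $h$ types is a symmetric function of the free type representation $(x_1,\ldots,x_{h-1})$ of the game; that is, $q_h(\mathbf{x})=q_h(\mathbf{y})$ whenever $\mathbf{x}$ and $\mathbf{y}$ are free type representations with $x_t=y_{h-t}$ for all $t=1,\ldots,h-1$.
   Context: A constant sum homogeneous weighted majority game on a finite player set $N$ is a simple game ($v(S)\in\{0,1\}$ for every $S\subseteq N$), constant sum ($v(S)+v(N\setminus S)=1$), admitting a (unique) minimal homogeneous representation $(q,\mathbf{w})$: the individual weights $w_j$ are integers in nondecreasing order, some players have weight $1$, $v(S)=1$ if and only if $w(S):=\sum_{j\in S}w_j\ge q$, with $q=\frac{1+w(N)}{2}$, and $w(S)=q$ for every minimal winning coalition $S$ (a coalition with $v(S)=1$ and $v(T)=0$ for all $T\subsetneq S$). The number $q$ is the minimal winning quota of the game. A parsimonious game ($P$ game) is a constant sum homogeneous weighted majority game with $n>3$ players, none of them dummy, having exactly $n$ minimal winning coalitions (the smallest possible number). Recalled facts about $P$ games (known, due to earlier work). Group the players by equal weight in the minimal homogeneous representation into $h$ types ($2\le h\le n-2$) with type weights $w_1<w_2<\cdots<w_h$, and let $x_t\geq 1$ be the number of players of type $t$. Then $x_1>1$, $x_{h-1}>1$, $x_h=1$. The vector $(x_1,\ldots,x_h)$ is the type representation, and $(x_1,\ldots,x_{h-1})$ is the free type representation; it determines the game. With the convention $w_0=0$, the type weights satisfy $w_1=1$, $w_t=x_{t-1}w_{t-1}+w_{t-2}$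 for $1<t<h$, and $w_h=(x_{h-1}-1)w_{h-1}+w_{h-2}$. $q_h(x_1,\ldots,x_{h-1})$ denotes the minimal winning quota of the $P$ game with $h$ types and free type representation $(x_1,\ldots,x_{h-1})$. *)

(* Defs.v *)
From mathcomp Require Import all_boot.

Set Implicit Arguments.
Unset Strict Implicit.
Unset Printing Implicit Defensive.

Section Games.

Variable N : finType.

Definition simple_game := {set N} -> bool.

(* Booleans are read as the values 0 and 1. *)
Definition constant_sum (v : simple_game) : Prop :=
  forall S : {set N}, v S + v (~: S) = 1.

Definition dummy (v : simple_game) (i : N) : Prop :=
  forall S : {set N}, v (i |: S) = v S.

Definition coalition_weight (w : N -> nat) (S : {set N}) : nat :=
  \sum_(j in S) w j.

(* Players are not assumed to be listed in order of weight: that is only a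
   labelling convention, and the types are sorted in [type_weights].
   [minset v S] says that S is an inclusion-minimal winning coalition. *)
Record minimal_homogeneous_repr (v : simple_game) (q : nat) (w : N -> nat)
    : Prop := MinimalHomogeneousRepr {
  mhr_unit_weight : exists j, w j = 1;
  mhr_winning : forall S : {set N}, v S = (q <= coalition_weight w S);
  mhr_quota : 2 * q = 1 + coalition_weight w [set: N];
  mhr_homogeneous :
    forall S : {set N}, minset v S -> coalition_weight w S = q
}.

Record parsimonious_game (v : simple_game) : Prop := ParsimoniousGame {
  pg_constant_sum : constant_sum v;
  pg_homogeneous : exists q w, minimal_homogeneous_repr v q w;
  pg_card : 3 < #|N|;
  pg_no_dummy : forall i, ~ dummy v i;
  pg_parsimonious : #|[set S : {set N} | minset v S]| = #|N|
}.

Definition type_weights (w : N -> nat) : seq nat :=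
  sort leq (undup (codom w)).

(* (x_1, ..., x_h), where x_t is the number of players of the t-th type. *)
Definition type_repr (w : N -> nat) : seq nat :=
  [seq #|[set j | w j == a]| | a <- type_weights w].

(* (x_1, ..., x_{h-1}) *)
Definition free_type_repr (w : N -> nat) : seq nat :=
  take (size (type_weights w)).-1 (type_repr w).

End Games.

(* The graph of q_h: [minimal_winning_quota x q] means that x is the free type
   representation of a parsimonious game with h types whose minimal winning
   quota is q. *)
Definition minimal_winning_quota (h : nat) (x : h.-1.-tuple nat) (q : nat)
    : Prop :=
  exists (N : finType) (v : simple_game N) (w : N -> nat),
    [/\ parsimonious_game v,
        minimal_homogeneous_repr v q w,
        size (type_weights w) = h
      & free_type_repr w = x].

(* Main.v *)
Require Import Defs.
From mathcomp Require Import all_boot zify.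

(* List the players by decreasing weight and build the minimal winning
   coalitions, which are exactly the coalitions of weight q, by deciding player
   after player.  A partial coalition is described by the weight it still
   misses; by the constant sum property, the amounts missing to a partial
   coalition and to its complement add up to one more than the weight of the
   remaining players.  As no player is a dummy, every player but the last must
   be optional in some partial coalition, so there are at least n minimal
   winning coalitions.  When there are exactly n of them, only one complementary
   pair of unfinished partial coalitions survives at each stage, which forces
   the weights to satisfy a linear recurrence.  It identifies q with the
   continuant K(x_1, ..., x_{h-1}), and continuants are invariant under
   reversal. *)

Set Implicit Arguments.
Unset Strict Implicit.
Unset Printing Implicit Defensive.

(** * Continuants and their reversal *)

Definition continuant_step (x : nat) (p : nat * nat) : nat * nat :=
  (x * p.1 + p.2, p.1).

(** On a nonempty list the second component of the fold is the continuant of the tail; the seed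
    [(1, 0)] is the empty continuant and its zero predecessor. *)
Definition continuant (l : seq nat) : nat :=
  (foldr continuant_step (1, 0) l).1.

(* Each step is given by the symmetric matrix [[x, 1], [1, 0]]. *)
Lemma continuant_step_adjoint (l : seq nat) (p p' : nat * nat) :
  let r := foldr continuant_step p l in
  let r' := foldr continuant_step p' (rev l) in
  r.1 * p'.1 + r.2 * p'.2 = p.1 * r'.1 + p.2 * r'.2.
Proof.
elim: l p' => [|x l IHl] p' //=.
rewrite rev_cons -cats1 foldr_cat /= -IHl /=; nia.
Qed.

Lemma continuant_rev (l : seq nat) : continuant (rev l) = continuant l.
Proof.
have /= := continuant_step_adjoint l (1, 0) (1, 0).
by rewrite /continuant !muln0 !addn0 muln1 mul1n.
Qed.

(** * Counting the subfamilies with a given sum in a decreasing list *)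

Fixpoint nb_subsums (l : seq nat) (k : nat) : nat :=
  if l is a :: r then
    (if a <= k then nb_subsums r (k - a) else 0) + nb_subsums r k
  else k == 0.

(* Unfolds the condition that the minimal subfamilies of the decreasing list [l]
   with sum at least [k] have sum exactly [k]. *)
Fixpoint homogeneous (l : seq nat) (k : nat) : Prop :=
  if l is a :: r then
    k = 0 \/ [/\ a <= k, homogeneous r (k - a) & homogeneous r k]
  else True.

(** Records that some subfamily of sum [k] contains the last element. This is what remains of the
    absence of dummies once players become weights. *)
Inductive uses_last : seq nat -> nat -> Prop :=
| UsesLastOne a : uses_last [:: a] a
| UsesLastIn a l k : uses_last l k -> uses_last (a :: l) (a + k)
| UsesLastOut a l k : uses_last l k -> uses_last (a :: l) k.

(** Either [a] has the type of [b], or it opens a new type. Summing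
    [w_t = x_{t-1} w_{t-1} + w_{t-2}] over the lower types turns the recurrence into
    [a = (sumn r).+1]. *)
Fixpoint parsimonious_weights (l : seq nat) : Prop :=
  if l is a :: l' then
    if l' is b :: r then
      [/\ a <= sumn l', a = b \/ a = (sumn r).+1 & parsimonious_weights l']
    else a = 1
  else False.

Lemma uses_last_bounds (l : seq nat) (k : nat) :
  all (leq 1) l -> uses_last l k -> 0 < k <= sumn l.
Proof.
move=> l_gt0 lk; elim: lk l_gt0 => {l k} [a|a l k _ IH|a l k _ IH];
  move=> /= /andP[a_gt0 l_gt0];
  try (have := IH l_gt0); lia.
Qed.

Lemma uses_last_cons (a k : nat) (l : seq nat) :
  l != [::] -> uses_last (a :: l) k ->
  (exists2 k', k = a + k' & uses_last l k') \/ uses_last l k.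
Proof.
move=> l_n0 H; inversion H; subst; [by []| |by right].
by left; exists k0.
Qed.

(** Greedy choice: by homogeneity, taking the elements in order never overshoots [k] before reaching
    it. *)
Lemma nb_subsums_gt0 (l : seq nat) (k : nat) :
  homogeneous l k -> k <= sumn l -> 0 < nb_subsums l k.
Proof.
have nb0 : forall l, 0 < nb_subsums l 0.
  by elim=> //= a r IHr; rewrite addn_gt0 IHr orbT.
elim: l k => [|a l IHl] k /=; first by case: k.
case=> [-> _|[ak Hka _] kl]; first exact: (nb0 (a :: l)).
by rewrite ak addn_gt0 IHl //; lia.
Qed.

(* [alpha] and [beta] are the amounts missing to two complementary sets of
   larger players.  The head [a] is optional for [alpha] iff
   [alpha <= sumn (behead l)]; otherwise [beta <= a], whence [beta = a] by
   homogeneity.  If [a] is optional for both, they split into two complementary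
   pairs, whence one coalition too many. *)
Lemma complementary_subsums (l : seq nat) (alpha beta : nat) :
    all (leq 1) l -> 0 < alpha -> 0 < beta -> alpha + beta = (sumn l).+1 ->
    homogeneous l alpha -> homogeneous l beta ->
    uses_last l alpha \/ uses_last l beta ->
  size l < nb_subsums l alpha + nb_subsums l beta /\
  (nb_subsums l alpha + nb_subsums l beta <= (size l).+1 ->
   (alpha = head 0 l \/ beta = head 0 l) /\ parsimonious_weights l).
Proof.
elim: l alpha beta => [|a l IHl] alpha beta.
  by move=> _ _ _ _ _ _ [] H; inversion H.
have [l0|l_n0] := eqVneq l [::].
  rewrite {}l0 => _ a0 b0 /= E [?|[aa _ _]]; first lia.
  case=> [?|[ab _ _]] _; first lia.
  have [-> [-> ->]] : a = 1 /\ alpha = 1 /\ beta = 1 by lia.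
  by split=> // _; split=> //; left.
have forced al be : all (leq 1) (a :: l) -> 0 < al -> 0 < be ->
    al + be = (sumn (a :: l)).+1 ->
    homogeneous (a :: l) al -> homogeneous (a :: l) be ->
    uses_last (a :: l) al \/ uses_last (a :: l) be ->
    al <= sumn l -> sumn l < be ->
  size (a :: l) < nb_subsums (a :: l) al + nb_subsums (a :: l) be /\
  (nb_subsums (a :: l) al + nb_subsums (a :: l) be <= (size (a :: l)).+1 ->
   al = a /\ parsimonious_weights (a :: l)).
  move=> /= /andP[a_gt0 l_gt0] al0 be0 E [|[aal Hal1 Hal2]]; first lia.
  case=> [?|[abe Hbe1 Hbe2]]; first lia.
  move=> U lal lbe.
  have Eal : al = a by lia.
  subst al.
  have U' : uses_last l a \/ uses_last l (be - a).
    case: U => /(uses_last_cons l_n0) [[k ek Uk]|Uk]; [|by left| |].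
    - by have := uses_last_bounds l_gt0 Uk; lia.
    - by right; rewrite ek addKn.
    - by have := uses_last_bounds l_gt0 Uk; lia.
  (* Taking [a] completes [al], which gives the one extra coalition; the others come from the pair
     [a], [be - a]. *)
  have := nb_subsums_gt0 Hal1.
  have [] := IHl a (be - a) l_gt0 a_gt0 _ _ Hal2 Hbe1 U'; [lia|lia|].
  rewrite leqnn abe => lb ub; rewrite subnn => /(_ isT) c0.
  split; first by move: lb c0; rewrite /=; lia.
  move=> ub'.
  have [|hd W] := ub; first by move: c0 ub'; rewrite /=; lia.
  split=> //.
  (* With [l = b :: r], the head condition reads [a = b] or [be = a + b]; the latter turns [E] into
     [a = (sumn r).+1]. *)
  case: l l_n0 hd W E lal {l_gt0 Hal1 Hal2 Hbe1 Hbe2 U U' lb ub ub' c0 lbe IHl}.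
    by [].
  by move=> b r _ /= hd W E lal; split=> //; lia.
move=> pos al0 be0 E Hal Hbe U.
case: (leqP alpha (sumn l)) => lal;
  case: (leqP beta (sumn l)) => lbe; last first.
- move: pos E Hal Hbe U => /= /andP[a_gt0 l_gt0] E.
  case=> [?|[aal Hal1 Hal2]]; first lia.
  case=> [?|[abe Hbe1 Hbe2]]; first lia.
  case=> /(uses_last_cons l_n0) [[k ek Uk]|Uk];
    by have := uses_last_bounds l_gt0 Uk; move: lal lbe; rewrite /=; lia.
- have [lb ub] := forced beta alpha pos be0 al0 (etrans (addnC _ _) E) Hbe Hal
    (iffLR (or_comm _ _) U) lbe lal.
  rewrite addnC; split=> // /ub [-> W]; split=> //; by right.
- have [lb ub] := forced alpha beta pos al0 be0 E Hal Hbe U lal lbe.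
  split=> // /ub [-> W]; split=> //; by left.
- suff big : (size (a :: l)).+1 <
      nb_subsums (a :: l) alpha + nb_subsums (a :: l) beta.
    by split; [exact: ltnW | lia].
  move: pos E Hal Hbe U => /= /andP[a_gt0 l_gt0] E.
  case=> [?|[aal Hal1 Hal2]]; first lia.
  case=> [?|[abe Hbe1 Hbe2]]; first lia.
  rewrite aal abe => U.
  have := nb_subsums_gt0 Hal1; have := nb_subsums_gt0 Hal2.
  have := nb_subsums_gt0 Hbe1; have := nb_subsums_gt0 Hbe2.
  have U' : (uses_last l alpha \/ uses_last l (beta - a)) \/
            (uses_last l (alpha - a) \/ uses_last l beta).
    case: U => /(uses_last_cons l_n0) [[k ek Uk]|Uk];
      [|by left; left| |by right; right].
    - by right; left; rewrite ek addKn.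
    - by left; right; rewrite ek addKn.
  move: lal lbe => /= lal lbe.
  (* The pair that uses the last element contributes at least [(size l).+1] by induction, the other
     one at least 2. *)
  case: U' => U'.
    by have [] := IHl alpha (beta - a) l_gt0 al0 _ _ Hal2 Hbe1 U'; lia.
  by have [] := IHl (alpha - a) beta l_gt0 _ be0 _ Hal1 Hbe2 U'; lia.
Qed.

(** * From the recurrence on weights to the continuant *)

Definition multiplicities (l : seq nat) : seq nat :=
  [seq count_mem a l | a <- undup l].

Lemma multiplicities_cons_notin (a : nat) (l : seq nat) :
  a \notin l -> multiplicities (a :: l) = 1 :: multiplicities l.
Proof.
move=> al; rewrite /multiplicities /= (negbTE al) /= eqxx (count_memPn al).
congr (_ :: _); apply/eq_in_map => b; rewrite mem_undup => bl /=.
by case: eqP => // eab; rewrite eab bl in al.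
Qed.

Lemma sorted_geq_notin (a b : nat) (l : seq nat) :
  sorted geq (b :: l) -> b < a -> a \notin b :: l.
Proof.
move=> Hl ba; rewrite inE; apply/norP; split; first lia.
apply/negP => al; have /allP/(_ _ al) /= : all (geq b) l.
  by apply: order_path_min Hl => x y z /=; lia.
by lia.
Qed.

Lemma undup_head (a : nat) (l : seq nat) : sorted geq (a :: l) ->
  exists2 u, undup (a :: l) = a :: u & a \notin u.
Proof.
elim: l => [|b l IHl] in a *; first by exists [::].
case: (eqVneq a b) => [<-|ab] /=.
  by rewrite inE eqxx /= => /andP[_ /IHl].
move=> /andP[leba Hl].
have abl : a \notin b :: l.
  by apply: sorted_geq_notin => //; move: leba ab => /=; lia.
by rewrite (negbTE abl); exists (undup (b :: l)); rewrite ?mem_undup.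
Qed.

(** One more player of the head type adds [a] to the first component. A new type prepends the
    multiplicity 1, and the old first component [(sumn r).+1] becomes its weight. *)
Lemma parsimonious_weights_continuant (a : nat) (r : seq nat) :
  sorted geq (a :: r) -> parsimonious_weights (a :: r) ->
  foldr continuant_step (1, 0) (multiplicities (a :: r)) = ((sumn r).+1, a).
Proof.
elim: r a => [|b r IHr] a; first by move=> _ /= ->.
move=> Hs [le_a Ea W].
have Hs' : sorted geq (b :: r) by case/andP: Hs.
have {IHr} := IHr b Hs' W.
case: (eqVneq a b) => [eab|ab].
  subst b; rewrite /multiplicities; have [u Eu au] := undup_head Hs'.
  have -> : undup [:: a, a & r] = undup (a :: r) by rewrite [LHS]/= inE eqxx.
  rewrite Eu /= !eqxx => -[E1 E2].
  have -> : [seq (a == x) + ((a == x) + count_mem x r) | x <- u] =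
            [seq (a == x) + count_mem x r | x <- u].
    by apply/eq_in_map => x xu; case: eqP => // ax; rewrite ax xu in au.
  rewrite {1}/continuant_step E2; rewrite E2 in E1.
  by congr (_, _); rewrite mulnDl mul1n -addnA E1 addnS.
have ar : a \notin b :: r.
  by apply: sorted_geq_notin => //; move: Hs ab => /= /andP[]; lia.
rewrite (multiplicities_cons_notin ar) /= => ->.
case: Ea => [eab|->]; first by rewrite eab eqxx in ab.
by rewrite /continuant_step /=; congr (_, _); lia.
Qed.

(** * Coalitions as subfamilies of a list of weights *)

Section CoalitionWeights.

Variables (T : finType) (w : T -> nat).
Implicit Types (S : {set T}) (s : seq T).

Lemma coalition_weightU1 (x : T) S :
  x \notin S -> coalition_weight w (x |: S) = w x + coalition_weight w S.
Proof. exact: big_setU1. Qed.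

Lemma coalition_weightD1 (x : T) S :
  x \in S -> coalition_weight w S = w x + coalition_weight w (S :\ x).
Proof. exact: big_setD1. Qed.

Lemma coalition_weight_sub S S' :
  S \subset S' -> coalition_weight w S <= coalition_weight w S'.
Proof.
move=> SS'; rewrite /coalition_weight [X in _ <= X](big_setID S) /=.
by rewrite (setIidPr SS') leq_addr.
Qed.

Lemma sub_cons_seq S (x : T) s :
  (S \subset x :: s) = (S :\ x \subset s).
Proof.
apply/subsetP/subsetP => [H y|H y yS].
  by rewrite !inE => /andP[yx /H]; rewrite inE (negbTE yx).
by rewrite inE; case: eqVneq => //= yx; apply: H; rewrite !inE yx.
Qed.

Lemma card_subsums s k : uniq s ->
  #|[set S : {set T} | (S \subset s) && (coalition_weight w S == k)]| =
  nb_subsums (map w s) k.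
Proof.
elim: s k => [|x s IHs] k /=.
  move=> _; transitivity #|[set S : {set T} | (S == set0) && (0 == k)]|.
    apply: eq_card => S; rewrite !inE.
    have -> : (S \subset [::]) = (S == set0).
      by rewrite -subset0; apply: eq_subset_r => y; rewrite !inE.
    by case: eqP => //= ->; rewrite /coalition_weight big_set0.
  rewrite eq_sym; case: (k == 0); last first.
    by apply: eq_card0 => S; rewrite !inE andbF.
  apply: etrans (cards1 (set0 : {set T})).
  by apply: eq_card => S; rewrite !inE andbT.
case/andP=> xs us.
rewrite -(cardsID [set S : {set T} | x \in S]); congr (_ + _); last first.
  rewrite -IHs //; apply: eq_card => S; rewrite !inE sub_cons_seq.
  case: (boolP (x \in S)) => /= xS; last first.
    have -> // : S :\ x = S.
    by apply/setP=> y; rewrite !inE; case: eqVneq => // ->; rewrite (negbTE xS).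
  by apply/esym/negbTE/negP => /andP[/subsetP/(_ x xS)]; rewrite (negbTE xs).
case: leqP => wk; last first.
  apply: eq_card0 => S; rewrite !inE.
  apply/negP => /andP[/andP[_ /eqP Sk] xS].
  by move: wk; rewrite -Sk (coalition_weightD1 xS); lia.
rewrite -IHs //; set D := (X in _ = #|pred_of_set X|).
rewrite -(card_in_imset (f := fun S => x |: S) (D := D)); last first.
  move=> S S'; rewrite !inE => /andP[/subsetP Ss _] /andP[/subsetP Ss' _] E.
  have xS : x \notin S by apply: contra xs => /Ss.
  have xS' : x \notin S' by apply: contra xs => /Ss'.
  by rewrite -(setU1K xS) E setU1K.
apply: eq_card => S; rewrite !inE sub_cons_seq; apply/idP/imsetP.
  move=> /andP[/andP[Ss Sk] xS]; exists (S :\ x); last by rewrite setD1K.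
  by rewrite inE Ss /=; move: Sk; rewrite (coalition_weightD1 xS); lia.
move=> [S']; rewrite inE => /andP[Ss' /eqP Sk] ->.
have xS' : x \notin S' by apply: contra xs => /(subsetP Ss').
by rewrite setU1K // Ss' setU11 andbT coalition_weightU1 // Sk subnKC /=.
Qed.

Lemma uses_last_coalition (x : T) s S : uniq (x :: s) ->
  S \subset x :: s -> last x s \in S ->
  uses_last (map w (x :: s)) (coalition_weight w S).
Proof.
elim: s x S => [|y s IHs] x S.
  move=> _ Sx /= xS; have -> : S = [set x].
    apply/eqP; rewrite eqEsubset sub1set xS andbT.
    by apply/subsetP => z /(subsetP Sx); rewrite !inE.
  by rewrite /coalition_weight big_set1; constructor.
move=> /andP[xs us] Sxs yS.
have lS : last y s \in S :\ x.
  rewrite !inE yS andbT; apply: contra xs => /eqP <-; exact: mem_last.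
move: Sxs; rewrite sub_cons_seq => Sxs.
have U := IHs y _ us Sxs lS.
case: (boolP (x \in S)) => xS.
  by rewrite (coalition_weightD1 xS); constructor.
constructor; have <- // : S :\ x = S.
by apply/setP=> z; rewrite !inE; case: eqVneq => // ->; rewrite (negbTE xS).
Qed.

End CoalitionWeights.

(** * The quota of a parsimonious game *)

Section ParsimoniousGame.

Variables (T : finType) (v : simple_game T) (q : nat) (w : T -> nat).
Hypotheses (pg : parsimonious_game v) (repr : minimal_homogeneous_repr v q w).
Implicit Types (S : {set T}) (s : seq T).

Let winning S : v S = (q <= coalition_weight w S).
Proof. exact: mhr_winning repr S. Qed.

Lemma weight_gt0 (i : T) : 0 < w i.
Proof.
rewrite lt0n; apply/eqP => wi0; apply: (pg_no_dummy pg (i := i)) => S.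
rewrite !winning; case: (boolP (i \in S)) => iS.
  by rewrite (setUidPr _) ?sub1set.
by rewrite coalition_weightU1 // wi0.
Qed.

Lemma winning_sub_quota S : q <= coalition_weight w S ->
  exists2 S' : {set T}, S' \subset S & coalition_weight w S' = q.
Proof.
rewrite -winning => /(@minset_exists _ v)[S' mS' S'S]; exists S' => //.
exact: mhr_homogeneous repr _ mS'.
Qed.

(** For the converse, weights are positive, so a coalition of weight [q] loses as soon as a player
    leaves. *)
Lemma minset_quota S : minset v S = (coalition_weight w S == q).
Proof.
apply/idP/eqP => [|Sq]; first exact: mhr_homogeneous repr _.
apply/minsetP; rewrite winning Sq leqnn; split=> // S' vS' S'S.
apply/eqP; rewrite eqEsubset S'S; apply/subsetP => x xS.
apply/negPn/negP => xS'.
have : coalition_weight w (x |: S') <= coalition_weight w S.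
  by apply: coalition_weight_sub; rewrite subUset sub1set xS.
move: vS'; rewrite winning coalition_weightU1 // Sq; have := weight_gt0 x; lia.
Qed.

(** [S] collects the larger players already chosen. If adding [x] to a losing [S] overshot [q], a
    coalition of weight [q] inside [x |: S] would miss some [y] at least as heavy as [x], hence
    weigh no more than [S]. *)
Lemma homogeneous_suffix s S :
    uniq s -> sorted geq (map w s) ->
    (forall x, x \in S -> x \notin s) ->
    (forall x y, x \in S -> y \in s -> w y <= w x) ->
    coalition_weight w S <= q ->
  homogeneous (map w s) (q - coalition_weight w S).
Proof.
elim: s S => [//|x s IHs] S /= /andP[xs us] Hs Ss leS Sq.
have xS : x \notin S by apply/negP => /Ss; rewrite inE eqxx.
have lex y : y \in s -> w y <= w x.
  move=> ys; have /allP/(_ (w y)) : all (geq (w x)) (map w s).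
    by apply: order_path_min Hs => a b c /=; lia.
  by apply; apply: map_f.
case: (ltnP (coalition_weight w S) q) => [Sltq|]; last by left; lia.
have wSx : w x + coalition_weight w S <= q.
  rewrite leqNgt; apply/negP => wq.
  have [|S' S'S S'q] := @winning_sub_quota (x |: S).
    by rewrite coalition_weightU1 // ltnW.
  have : S' \proper x |: S.
    rewrite properEneq S'S andbT; apply/eqP => ES.
    by move: wq; rewrite -S'q ES coalition_weightU1 // ltnn.
  case/properP=> _ [y]; rewrite !inE => /orP[/eqP->|yS] yS'.
    have : S' \subset S.
      apply/subsetP => z zS'; move: (subsetP S'S z zS'); rewrite !inE.
      by case: eqP => //= zx; rewrite -zx zS' in yS'.
    by move/(coalition_weight_sub w); lia.
  have : S' \subset (x |: S) :\ y by rewrite subsetD1 S'S.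
  move/(coalition_weight_sub w).
  have : coalition_weight w (x |: S) = w y + coalition_weight w ((x |: S) :\ y).
    by apply: coalition_weightD1; rewrite inE yS orbT.
  by rewrite coalition_weightU1 //; have := leS y x yS (mem_head _ _); lia.
right; split; first by lia.
- have -> : q - coalition_weight w S - w x = q - coalition_weight w (x |: S).
    by rewrite coalition_weightU1 //; lia.
  apply: IHs => //.
  + exact: path_sorted Hs.
  + move=> y; rewrite !inE => /orP[/eqP-> //|/Ss].
    by rewrite inE negb_or => /andP[].
  + move=> y z; rewrite !inE => /orP[/eqP-> /lex //|yS zs].
    by apply: leS => //; rewrite inE zs orbT.
  + by rewrite coalition_weightU1.
- apply: IHs => //.
  + exact: path_sorted Hs.
  + by move=> y /Ss; rewrite inE negb_or => /andP[].
  + by move=> y z yS zs; apply: leS => //; rewrite inE zs orbT.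
Qed.

(** Otherwise each minimal winning coalition inside [i |: S] would lie in [S], and [i] would be a
    dummy. *)
Lemma exists_quota_coalition (i : T) :
  exists2 S : {set T}, i \in S & coalition_weight w S = q.
Proof.
case: (pickP (fun S => (coalition_weight w S == q) && (i \in S))).
  by move=> S /andP[/eqP Sq iS]; exists S.
move=> noS; case: (pg_no_dummy pg (i := i)) => S.
rewrite !winning; apply/idP/idP => [iSq|]; last first.
  by move/leq_trans; apply; apply: coalition_weight_sub; apply: subsetUr.
have [S' S'S S'q] := winning_sub_quota iSq.
rewrite -S'q; apply: coalition_weight_sub; apply/subsetP => z zS'.
move: (subsetP S'S z zS'); rewrite !inE => /orP[/eqP zi|//].
by have := noS S'; rewrite S'q eqxx -zi zS'.
Qed.

Lemma quota_free_type_repr : q = continuant (free_type_repr w).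
Proof.
pose s := sort (fun x y => w y <= w x) (enum T).
have sorted_s : sorted geq (map w s).
  by rewrite sorted_map; apply: sort_sorted => x y; exact: leq_total.
have us : uniq s by rewrite sort_uniq enum_uniq.
have mem_s x : x \in s by rewrite mem_sort mem_enum.
have size_s : size s = #|T| by rewrite size_sort cardE.
have sum_s : sumn (map w s) = coalition_weight w [set: T].
  rewrite sumnE big_map (perm_big (enum T)) /=; last by rewrite perm_sort.
  by rewrite /coalition_weight big_enum; apply: eq_bigl => x; rewrite in_setT.
have pos_s : all (leq 1) (map w s).
  by apply/allP => _ /mapP[x _ ->]; exact: weight_gt0.
have hom_s : homogeneous (map w s) q.
  have := @homogeneous_suffix s set0 us sorted_s.
  rewrite /coalition_weight big_set0 subn0.
  by apply=> //; [move=> x|move=> x y]; rewrite inE.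
have count_s : nb_subsums (map w s) q = #|T|.
  rewrite -(pg_parsimonious pg) -card_subsums //; apply: eq_card => S.
  rewrite !inE minset_quota; case: (S \subset s) / subsetP => // H.
  by case: H => x _; exact: mem_s.
have quota_s : 2 * q = 1 + sumn (map w s).
  by rewrite sum_s; exact: mhr_quota repr.
have codom_s : codom w =i map w s.
  move=> a; apply/codomP/mapP => [[x ->]|[x _ ->]]; last by exists x.
  by exists x; rewrite ?mem_s.
have card_type a : #|[set j | w j == a]| = count_mem a (map w s).
  rewrite count_map (permP (permEl (perm_sort _ _))) -sum1_count big_enum_cond.
  by rewrite -sum1_card; apply: eq_bigl => j; rewrite inE.
have types : type_weights w = rev (undup (map w s)).
  apply: (sorted_eq leq_trans anti_leq); first exact/sort_sorted/leq_total.
    rewrite rev_sorted; apply: subseq_sorted sorted_s; last exact: undup_subseq.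
    by move=> x y z /=; lia.
  rewrite perm_sort perm_sym perm_rev perm_sym.
  by apply: uniq_perm; rewrite ?undup_uniq // => a; rewrite !mem_undup codom_s.
have use_last x s' : s = x :: s' -> uses_last (map w s) q.
  move=> Es; have [S lS Sq] := exists_quota_coalition (last x s').
  rewrite -Sq Es; apply: uses_last_coalition; rewrite -?Es //.
  by apply/subsetP => y _; exact: mem_s.
have {use_last} : uses_last (map w s) q.
  case Es: s => [|x s']; last by rewrite -Es; exact: use_last Es.
  by have := pg_card pg; rewrite -size_s Es.
rewrite /free_type_repr /type_repr (eq_map card_type) types size_rev.
move: count_s (pg_card pg); rewrite -size_s -(size_map w s).
move: (map w s) sorted_s pos_s hom_s quota_s.
case=> [//|a l] Hs /= /andP[a_gt0 l_gt0] Hq quota_s count_q size_gt3.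
case: Hq => [?|[aq Hqa Hq]]; first lia.
have l_n0 : l != [::] by move: size_gt3; case: (l).
move=> /(uses_last_cons l_n0) U.
have U' : uses_last l (q - a) \/ uses_last l q.
  by case: U => [[k -> Uk]|]; [left; rewrite addKn|right].
have aq' : a < q.
  by case: U => [[k Ek Uk]|Uk]; have := uses_last_bounds l_gt0 Uk; lia.
(* By [quota_s], [q - a] and [q] add up to [(sumn l).+1]: they are what the largest player and its
   absence leave missing. *)
have [|||_] := complementary_subsums l_gt0 _ _ _ Hqa Hq U'; [lia|lia|lia|].
move: count_q; rewrite aq => -> /(_ (leqnn _)) [Ehd W].
have [b [r El]] : exists b r, l = b :: r.
  by case: (l) l_n0 => // b r; exists b, r.
have Hl : sorted geq l by exact: path_sorted Hs.
have quota_ab : q = (sumn r).+1 /\ b < a.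
  (* Since [b <= a < q], the head condition gives [q = a + b], and [quota_s] the value of [q]. If
     [a = b], then [b = c] and [c] exceeds the sum of the rest, against [le_c], which is available
     because there are more than three players. *)
  subst l; move: size_gt3 Ehd W Hs quota_s aq' {Hl Hqa Hq U U' l_gt0 l_n0}.
  case: r => [|c [|d r]] //= _ Ehd [le_b Eb [le_c _ _]] /andP[ba _].
  lia.
have al : a \notin l.
  by subst l; apply: sorted_geq_notin => //; case: quota_ab.
(* The largest player is alone in its type, so [take] drops exactly its entry and leaves the
   reversal of [multiplicities l]. *)
rewrite -[X in take _ X]/[seq count_mem i (a :: l) | i <- rev (undup (a :: l))].
rewrite map_rev -/(multiplicities (a :: l)) multiplicities_cons_notin //.
rewrite (negbTE al) rev_cons -cats1 take_size_cat; last first.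
  by rewrite size_rev size_map.
rewrite continuant_rev /continuant; subst l.
by rewrite parsimonious_weights_continuant //; case: quota_ab.
Qed.

End ParsimoniousGame.

(* In the 1-based indexing of types, [rev_ord] on 'I_h.-1 is t |-> h - t. *)
Theorem theorem7p1 (h : nat) (hh : 2 <= h) (x y : h.-1.-tuple nat)
    (qx qy : nat)
    (Hx : minimal_winning_quota x qx)
    (Hy : minimal_winning_quota y qy)
    (Hxy : forall t : 'I_h.-1, tnth x t = tnth y (rev_ord t)) :
  qx = qy.
Proof.
have quota (z : h.-1.-tuple nat) r :
    minimal_winning_quota z r -> r = continuant z.
  by move=> [T [v [w [pg repr _ <-]]]]; exact: quota_free_type_repr pg repr.
rewrite (quota _ _ Hx) (quota _ _ Hy) -continuant_rev; congr continuant.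
apply: (@eq_from_nth _ 0) => [|i]; rewrite size_rev !size_tuple // => ih.
have ih' : h.-1 - i.+1 < h.-1 by lia.
rewrite nth_rev ?size_tuple // -(tnth_nth 0 y (Ordinal ih)).
rewrite -(tnth_nth 0 x (Ordinal ih')) Hxy; congr tnth.
by apply: val_inj => /=; lia.
Qed.
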